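(* Let $q,\beta>0$, $0<\alpha<1$, $n\in\mathbb{N}$ with $n^{1-\alpha}>2$, $x\in\mathbb{R}$, $N\in\mathbb{N}$, and $f\in C^N(\mathbb{R})$ with $f^{(N)}\in C_B(\mathbb{R})$. Put $$\sigma_n:=\omega\left(f^{(N)},\frac1n+\frac1{n^\alpha}\right)\frac{\left(\frac1n+\frac1{n^\alpha}\right)^N}{N!}+\frac{2^N\|f^{(N)}\|_\infty}{n^N N!}\left(q+\frac1q\right)e^{\beta}e^{-\frac{\beta n^{1-\alpha}}{2}}\left[1+\frac{2^{N+1}N!}{\beta^N}\right].$$ Then: (i) $$\left|B_n^*(f)(x)-f(x)-\sum_{k=1}^N\frac{f^{(k)}(x)}{k!}B_n^*\left((\cdot-x)^k\right)(x)\right|\le\sigma_n,$$ and $\sigma_n\to0$ as $n\to\infty$. (ii) If $f^{(k)}(x)=0$ for $k=1,\dots,N$, then $|B_n^*(f)(x)-f(x)|\le\sigma_n$. (iii) $$|B_n^*(f)(x)-f(x)|\le\sum_{k=1}^N\frac{|f^{(k)}(x)|}{k!}\frac{2^{k-1}}{n^k}\left[1+\frac{1-e^{-\beta}}{1+e^{-\beta}}\cdot\frac1{k+1}+\left(q+\frac1q\right)\frac{e^\beta k!}{\beta^k}\right]+\sigma_n.$$ (iv) $$\|B_n^*(f)-f\|_\infty\le\sum_{k=1}^N\frac{\|f^{(k)}\|_\infty}{k!}\frac{2^{k-1}}{n^k}\left[1+\frac{1-e^{-\beta}}{1+e^{-\beta}}\cdot\frac1{k+1}+\left(q+\frac1q\right)\frac{e^\beta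 k!}{\beta^k}\right]+\sigma_n.$$
   Context: $\mathbb{N}=\{1,2,\dots\}$. For $q,\beta>0$ and $x\in\mathbb{R}$ let $\nu_{q}(x)=\frac{1-qe^{-\beta x}}{1+qe^{-\beta x}}$ and $G_{q,\beta}(x)=\frac14\left(\nu_{q}(x+1)-\nu_{q}(x-1)\right)$; $G_{1/q,\beta}$ is the same with $q$ replaced by $1/q$. Let $\Psi=\frac12\left(G_{q,\beta}+G_{1/q,\beta}\right)$ (an even probability density on $\mathbb{R}$). $C_B(\mathbb{R})$ is the set of continuous bounded real functions on $\mathbb{R}$; $C^N(\mathbb{R})$ is the set of $N$ times continuously differentiable real functions. $\|g\|_\infty=\sup_{x\in\mathbb{R}}|g(x)|\in[0,\infty]$ (the bound (iv) is vacuous if some $\|f^{(k)}\|_\infty$ is infinite). For $\theta>0$, $\omega(g,\theta)=\sup\{|g(x)-g(y)|: x,y\in\mathbb{R},\ |x-y|\le\theta\}$. The (Kantorovich type) operator $B_n^*$ is $$B_n^*(f)(x)=n\int_{-\infty}^{\infty}\left(\int_0^{1/n}f\left(h+\frac vn\right)dh\right)\Psi(nx-v)\,dv ,$$ applied also to unbounded functions for which the integral converges absolutely; in particular $B_n^*\left((\cdot-x)^k\right)(x)=n\int_{-\infty}^\infty\left(\int_0^{1/n}\left(t+\frac vn-x\right)^kdt\right)\Psi(nx-v)\,dv$. *)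

(* Defs.v *)
From HB Require Import structures.
From mathcomp Require Import all_boot all_order all_algebra.
From mathcomp Require Import all_classical all_reals all_analysis.
Set Implicit Arguments.
Unset Strict Implicit.
Unset Printing Implicit Defensive.
Import Order.TTheory GRing.Theory Num.Theory.
Import numFieldNormedType.Exports.
Local Open Scope classical_set_scope.
Local Open Scope ring_scope.

Definition nu (R : realType) (beta q x : R) : R :=
  (1 - q * expR (- (beta * x))) / (1 + q * expR (- (beta * x))).

Definition G (R : realType) (beta q x : R) : R :=
  4^-1 * (nu beta q (x + 1) - nu beta q (x - 1)).

Definition Psi (R : realType) (beta q x : R) : R :=
  2^-1 * (G beta q x + G beta q^-1 x).

(* [derive1n k f] is a total function, so the existence of the derivatives up
   to order N has to be required; those of order k < N are then continuous. *)
Definition CN (R : realType) (N : nat) (f : R -> R) : Prop :=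
  (forall (k : nat) (x : R), (k < N)%N -> derivable (derive1n k f) x 1) /\
  continuous (derive1n N f).

Definition CB (R : realType) (g : R -> R) : Prop :=
  continuous g /\ exists M : R, forall x : R, `|g x| <= M.

(* The quantities below live in \bar R: suprema may be infinite, and since the
   Lebesgue integral of a measurable function is finite exactly when the
   integral converges absolutely (+oo - +oo = -oo), a finite bound on an
   expression in [Bstar] also asserts that convergence. *)
Local Open Scope ereal_scope.

Definition supnorm (R : realType) (g : R -> \bar R) : \bar R :=
  ereal_sup [set `|g x| | x in [set: R]].

Definition modcont (R : realType) (g : R -> R) (theta : R) : \bar R :=
  ereal_sup [set (`|g p.1 - g p.2|%R)%:E
            | p in [set p : R * R | (`|p.1 - p.2| <= theta)%R]].

Definition Bstar (R : realType) (beta q : R) (n : nat) (f : R -> R) (x : R) :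
    \bar R :=
  (n%:R)%:E *
  \int[lebesgue_measure]_v
    ((\int[lebesgue_measure]_(h in `[0%R, (n%:R^-1)%R]) (f (h + v / n%:R)%R)%:E)
     * (Psi beta q (n%:R * x - v)%R)%:E).

Definition sigma (R : realType) (beta q alpha : R) (N : nat) (f : R -> R)
    (n : nat) : \bar R :=
  let delta : R := (n%:R^-1 + (n%:R `^ alpha)^-1)%R in
  modcont (derive1n N f) delta * (delta ^+ N / N`!%:R)%R%:E +
  supnorm (EFin \o derive1n N f) *
  (2 ^+ N / (n%:R ^+ N * N`!%:R) * (q + q^-1) * expR beta
   * expR (- (beta * n%:R `^ (1 - alpha) / 2))
   * (1 + 2 ^+ N.+1 * N`!%:R / beta ^+ N))%R%:E.

(* The upper bound on |Bstar ((. - x)^k) x|, uniform in x, for 1 <= k. *)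
Definition momcoef (R : realType) (beta q : R) (n k : nat) : R :=
  (2 ^+ k.-1 / n%:R ^+ k
   * (1 + (1 - expR (- beta)) / (1 + expR (- beta)) * (k.+1%:R)^-1
      + (q + q^-1) * (expR beta * k`!%:R / beta ^+ k)))%R.

(* Main.v *)
(** Writing [u = n x - v], every node [h + v / n] with [0 <= h <= 1/n] lies within
    [(1 + |u|) / n] of [x], and [Bstar] averages over [u] against the even
    probability density [Psi], which satisfies
    [Psi u <= (q + 1/q) / 2 * expR b * (b * expR (- b |u|))].
    Expanding [f] at [x] to order [N], the Taylor rest at distance [r] is at most
    [modcont (f^(N)) r * r^N / N!], and at most [2 |f^(N)|_oo r^N / N!]. The former is
    used for [|u| < T := n^(1 - alpha)], where [r <= 1/n + 1/n^alpha], and the latter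
    for [|u| >= T], where half of the exponential decay of [Psi] gives the factor
    [expR (- b T / 2)] and the other half integrates [|u|^N]. *)

Require Import Defs.
From HB Require Import structures.
From mathcomp Require Import all_boot all_order all_algebra.
From mathcomp Require Import all_classical all_reals all_analysis.
From mathcomp Require Import measurable_realfun ring lra.
Import Order.TTheory GRing.Theory Num.Theory.
Import numFieldNormedType.Exports.
Local Open Scope classical_set_scope.
Local Open Scope ring_scope.

Set Implicit Arguments.
Unset Strict Implicit.

(** The obstacle is that integrals live in [\bar R] and that [f] may be unbounded, so [Bstar] is
    additive only where convergence is already known. Every estimate therefore goes through a
    dominating function of [u] alone, which yields convergence and the bound together; [f] is then
    rebuilt from its Taylor rest by adding monomials, and its own convergence comes out of this. The
    constants arise as follows. For the moments, [(1 + |u|)^k <= 2^(k-1) (1 + |u|^k)] gives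
    [2 ^+ k.-1 / n%:R ^+ k]; the summand 1 is the mass of [Psi], and [k! / b^k] is a gamma integral.
    In [sigma], [2 ^+ N] is [2 ^+ N.-1] times the 2 of [2 |f^(N)|_oo], and [2 ^+ N.+1 * N! / b ^+ N]
    is [2 * N! / (b / 2) ^+ N], where [b / 2] is the decay rate left after the other half is
    spent. *)

Section kernel.
Context {R : realType}.
Implicit Types (b q x y : R).

Lemma nu_den_gt0 b q x : 0 < q -> 0 < 1 + q * expR (- (b * x)).
Proof. by move=> q0; rewrite addr_gt0// mulr_gt0// expR_gt0. Qed.

(** Numerator and denominator are multiplied by [q * expR (- (b * x))]. Reflection thus exchanges
    [q] and [q^-1], which is what makes the average [Psi] even. *)
Lemma nu_opp b q x : 0 < q -> nu b q^-1 (- x) = - nu b q x.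
Proof.
move=> q0; rewrite /nu mulrN opprK expRN.
have := expR_gt0 (b * x); move: (expR (b * x)) => e e0.
field; rewrite !gt_eqF// ?addr_gt0//.
Qed.

Lemma G_opp b q x : 0 < q -> G b q^-1 (- x) = G b q x.
Proof.
move=> q0; rewrite /G (_ : - x + 1 = - (x - 1)); last by ring.
rewrite (_ : - x - 1 = - (x + 1)); last by ring.
by rewrite !nu_opp//; ring.
Qed.

Lemma Psi_even b q x : 0 < q -> Psi b q (- x) = Psi b q x.
Proof.
move=> q0; rewrite /Psi G_opp// -[q in G b q (- x)]invrK G_opp ?invr_gt0//.
by rewrite addrC.
Qed.

(** Over the common denominator the difference collapses to a single product, from which both the
    sign and the decay can be read off. *)
Lemma GE b q x : 0 < q ->
  G b q x = 2^-1 * (q * expR (- (b * x)) * (expR b - expR (- b))) /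
    ((1 + q * expR (- (b * (x + 1)))) * (1 + q * expR (- (b * (x - 1))))).
Proof.
move=> q0; have e1 : expR (- (b * (x + 1))) = expR (- (b * x)) / expR b.
  by rewrite mulrDr mulr1 opprD expRD (expRN b).
have e2 : expR (- (b * (x - 1))) = expR (- (b * x)) * expR b.
  by rewrite mulrBr mulr1 opprB addrC expRD.
rewrite /G /nu e1 e2 (expRN b).
have := expR_gt0 (- (b * x)); have := expR_gt0 b.
move: (expR b) (expR (- (b * x))) => E a E0 a0.
field; rewrite !gt_eqF// ?addr_gt0// ?mulr_gt0//.
Qed.

Lemma G_ge0 b q x : 0 <= b -> 0 < q -> 0 <= G b q x.
Proof.
move=> b0 q0; rewrite GE//; apply: divr_ge0.
  by rewrite !mulr_ge0 ?expR_ge0 ?invr_ge0 ?(ltW q0)// subr_ge0 ler_expR; lra.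
by rewrite ltW// mulr_gt0// nu_den_gt0.
Qed.

(** Both factors of the denominator are at least 1 and are dropped. The factor [b] is kept because
    [b * expR (- (b * x))] has mass 1 on the half-line when [0 < b]. *)
Lemma G_le b q x : 0 <= b -> 0 < q ->
  G b q x <= b * q * expR b * expR (- (b * x)).
Proof.
move=> b0 q0; rewrite GE//.
have a0 := expR_gt0 (- (b * x)).
have E0 := expR_gt0 b.
(* This is [1 - 2 b <= expR (- 2 b)] multiplied by [expR b]. *)
have Eb : expR b - expR (- b) <= 2 * b * expR b.
  have : 1 + - (b *+ 2) <= expR (- (b *+ 2)) by exact: expR_ge1Dx.
  rewrite -(ler_pM2r E0) -expRD (_ : - (b *+ 2) + b = - b); last by ring.
  by lra.
have d1 : 1 <= (1 + q * expR (- (b * (x + 1)))) * (1 + q * expR (- (b * (x - 1)))).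
  by rewrite mulr_ege1// lerDl mulr_ge0 ?expR_ge0 ?ltW.
have d0 := lt_le_trans ltr01 d1.
rewrite ler_pdivrMr//; apply: (@le_trans _ _ (b * q * expR b * expR (- (b * x)))).
  move: a0 E0 Eb; move: (expR _) (expR b) (expR (- b)) => a E E' a0 E0 Eb.
  have := ler_wpM2l (mulr_ge0 (ltW q0) (ltW a0)) Eb; lra.
by rewrite ler_peMr// !mulr_ge0// ltW.
Qed.

Lemma Psi_ge0 b q x : 0 <= b -> 0 < q -> 0 <= Psi b q x.
Proof.
by move=> b0 q0; rewrite mulr_ge0// ?addr_ge0 ?G_ge0// ?invr_gt0.
Qed.

Lemma Psi_le b q x : 0 <= b -> 0 < q ->
  Psi b q x <= 2^-1 * (q + q^-1) * expR b * (b * expR (- (b * `|x|))).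
Proof.
(* For negative arguments the bound of [G_le] grows; evenness moves the argument to [|x|] first. *)
move=> b0 q0; have -> : Psi b q x = Psi b q `|x|.
  by have [//|x0] := ger0P x; rewrite Psi_even.
rewrite /Psi; move: `|x| => y.
have := G_le y b0 q0.
have : G b q^-1 y <= _ := G_le y b0 _; rewrite invr_gt0 => /(_ q0).
move: (G b q y) (G b q^-1 y) (expR b) (expR _) => u v E a; lra.
Qed.

End kernel.

(** * Integrals of powers times exponentials over a half-line *)

Section half_line_integrals.
Context {R : realType}.
Implicit Types (b q x y : R).
Local Notation mu := (@lebesgue_measure R).

Lemma ge0_integral_primitive_y (f F : R -> R) (a l : R) :
  (forall x, a <= x -> 0 <= f x) -> continuous f ->
  (forall x, is_derive x (1 : R) F (f x)) -> F x @[x --> +oo] --> l ->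
  (\int[mu]_(x in `[a, +oo[) (f x)%:E = (l - F a)%:E)%E.
Proof.
move=> f0 cf dF Fl; have cF : continuous F.
  move=> x; apply/differentiable_continuous/derivable1_diffP.
  exact: (@ex_derive _ _ _ _ _ _ _ (dF x)).
rewrite (@ge0_continuous_FTC2y _ f F a l) ?EFinB//.
- exact: continuous_subspaceT.
- exact/cvg_at_right_filter/cF.
- by move=> x _; rewrite derive1E; exact: (@derive_val _ _ _ _ _ _ _ (dF x)).
Qed.

Lemma is_derive_exprn n x :
  is_derive x (1 : R) (fun y => y ^+ n) (n%:R * x ^+ n.-1).
Proof.
apply: DeriveDef; first exact: exprn_derivable.
by rewrite exp_derive [LHS]mulr1.
Qed.

Lemma is_derive_expRN b x :
  is_derive x (1 : R) (fun y => expR (- (b * y))) (- b * expR (- (b * x))).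
Proof.
have -> : (fun y => expR (- (b * y))) = expR \o ((- b) *: (@id R)).
  by apply/funext => y /=; rewrite -mulNr.
apply: is_derive_eq; rewrite /= -mulNr /GRing.scale/=.
by ring.
Qed.

Lemma continuous_expRN b : continuous (fun y => expR (- (b * y)) : R).
Proof.
move=> x; apply/differentiable_continuous/derivable1_diffP.
exact: (@ex_derive _ _ _ _ _ _ _ (is_derive_expRN b x)).
Qed.

Lemma cvg_expRNy b : 0 < b -> expR (- (b * y)) @[y --> +oo] --> (0 : R).
Proof.
move=> b0; apply: (@cvg_comp _ _ _ _ (fun z => expR (- z)) _ (pinfty_nbhs R)).
  exact: gt0_cvgMry.
exact: cvgr_expR.
Qed.

Lemma integral_expR_tail b a : 0 < b ->
  (\int[mu]_(x in `[a, +oo[) (b * expR (- (b * x)))%:E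
    = (expR (- (b * a)))%:E)%E.
Proof.
move=> b0.
have dF x : is_derive x (1 : R) (fun y => - expR (- (b * y))) (b * expR (- (b * x))).
  by have ? := is_derive_expRN b x; apply: is_derive_eq; rewrite mulNr opprK.
rewrite (ge0_integral_primitive_y _ _ dF (l := 0)).
- by rewrite opprK add0r.
- by move=> x _; rewrite mulr_ge0 ?expR_ge0// ltW.
- by move=> x; apply: cvgM; [exact: cvg_cst|exact: continuous_expRN].
- by rewrite -[X in _ --> X]oppr0; apply: cvgN; exact: cvg_expRNy.
Qed.

(** The term of order [k.+1] in the exponential series bounds the product by [c / y]; taking one
    order more than [k] leaves the factor [y^-1]. *)
Lemma cvg_exprn_expRNy b k : 0 < b ->
  y ^+ k * expR (- (b * y)) @[y --> +oo] --> (0 : R).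
Proof.
move=> b0; pose c : R := k.+1`!%:R / b ^+ k.+1.
apply: (@squeeze_cvgr _ _ _ _ (cst 0) (fun y : R => c * y^-1)); last 2 first.
- exact: cvg_cst.
- rewrite -[X in _ --> X](mulr0 c); apply: cvgM; first exact: cvg_cst.
  by apply/gtr0_cvgV0; [exact: nbhs_pinfty_gt|exact: cvg_id].
near=> y; have y0 : 0 < y by near: y; exact: nbhs_pinfty_gt.
rewrite mulr_ge0 ?expR_ge0 ?exprn_ge0 ?(ltW y0)//=.
rewrite expRN ler_pdivrMr ?expR_gt0//.
have : 1 + (b * y) ^+ k.+1 / k.+1`!%:R <= expR (b * y).
  by apply: expR_ge1Dxn; rewrite mulr_ge0 ?ltW.
move=> H; have {}H : (b * y) ^+ k.+1 / k.+1`!%:R <= expR (b * y).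
  by apply: le_trans H; rewrite lerDr.
have c0 : 0 < c / y by rewrite !divr_gt0 ?exprn_gt0// ltr0n fact_gt0.
apply: le_trans (ler_wpM2l (ltW c0) H); rewrite le_eqVlt; apply/orP; left.
apply/eqP; rewrite /c exprMn exprS [y ^+ k.+1]exprS; field.
by rewrite !gt_eqF ?exprn_gt0 ?ltr0n ?fact_gt0.
Unshelve. all: end_near. Qed.

(* Integration by parts, as a recursion: the derivative is [b * x ^+ k * expR (- b x)]. *)
Fixpoint gamma_primitive b k (x : R) : R :=
  if k is k'.+1 then
    k'.+1%:R / b * gamma_primitive b k' x - x ^+ k'.+1 * expR (- (b * x))
  else - expR (- (b * x)).

Lemma gamma_primitive0 b k : 0 < b -> gamma_primitive b k 0 = - (k`!%:R / b ^+ k).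
Proof.
move=> b0; elim: k => [|k IH] /=; first by rewrite mulr0 oppr0 expR0 divr1.
rewrite IH expr0n/= mul0r subr0 factS natrM exprS; field.
by rewrite !gt_eqF ?exprn_gt0.
Qed.

Lemma is_derive_gamma_primitive b k x : 0 < b ->
  is_derive x (1 : R) (gamma_primitive b k) (b * (x ^+ k * expR (- (b * x)))).
Proof.
move=> b0; have dE := is_derive_expRN b x.
elim: k => [|k IH].
  by rewrite /=; apply: is_derive_eq; rewrite expr0; ring.
have -> : gamma_primitive b k.+1 = (k.+1%:R / b) *: gamma_primitive b k -
    (fun y => y ^+ k.+1) * (fun y => expR (- (b * y))) by apply/funext.
have dX := is_derive_exprn k.+1 x.
apply: is_derive_eq; rewrite /GRing.scale/= exprS; field.
by rewrite gt_eqF.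
Qed.

Lemma cvg_gamma_primitive b k : 0 < b ->
  gamma_primitive b k y @[y --> +oo] --> (0 : R).
Proof.
move=> b0; elim: k => [|k IH] /=.
  by rewrite -[X in _ --> X]oppr0; apply: cvgN; exact: cvg_expRNy.
rewrite -[X in _ --> X](subr0 0) -[X in X - _](mulr0 (k.+1%:R / b)).
by apply: cvgB; [apply: cvgM => //; exact: cvg_cst|exact: cvg_exprn_expRNy].
Qed.

(** [gamma_primitive] vanishes at infinity, so the integral is minus its value at 0. The factor [b]
    in the integrand lowers the exponent of [b] from [k.+1] to [k]. *)
Lemma integral_exprn_expR b k : 0 < b ->
  (\int[mu]_(x in `[0%R, +oo[) (b * (x ^+ k * expR (- (b * x))))%:E
    = (k`!%:R / b ^+ k)%:E)%E.
Proof.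
move=> b0; have dF x := is_derive_gamma_primitive k x b0.
rewrite (ge0_integral_primitive_y _ _ dF (l := 0)).
- by rewrite gamma_primitive0// opprK add0r.
- by move=> x x0; rewrite !mulr_ge0 ?expR_ge0 ?exprn_ge0// ltW.
- move=> x; apply: cvgM; first exact: cvg_cst.
  by apply: cvgM; [exact: exprn_continuous|exact: continuous_expRN].
- exact: cvg_gamma_primitive.
Qed.

End half_line_integrals.

(** * Continuity of the kernel and its mass on the half-line *)

Section kernel_mass.
Context {R : realType}.
Implicit Types (b q x y : R).
Local Notation mu := (@lebesgue_measure R).

Lemma continuous_nu b q : 0 < q -> continuous (nu b q : R -> R).
Proof.
move=> q0 x; have cE : q * expR (- (b * y)) @[y --> x] --> q * expR (- (b * x)).
  by apply: cvgM; [exact: cvg_cst|exact: continuous_expRN].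
apply: cvgM; first by apply: cvgB => //; exact: cvg_cst.
apply: cvgV; first by rewrite gt_eqF// nu_den_gt0.
by apply: cvgD => //; exact: cvg_cst.
Qed.

Lemma continuous_G b q : 0 < q -> continuous (G b q : R -> R).
Proof.
move=> q0 x; apply: cvgM; first exact: cvg_cst.
have cnu c : nu b q (y + c) @[y --> x] --> nu b q (x + c).
  apply: (@cvg_comp _ _ _ (fun y => y + c) _ _ (nbhs (x + c))); last exact: continuous_nu.
  by apply: cvgD; [exact: cvg_id|exact: cvg_cst].
by apply: cvgB; exact: cnu.
Qed.

Lemma continuous_Psi b q : 0 < q -> continuous (Psi b q : R -> R).
Proof.
move=> q0 x; apply: cvgM; first exact: cvg_cst.
by apply: cvgD; apply: continuous_G; rewrite ?invr_gt0.
Qed.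

(** A primitive of [b / 2 * (nu b q x - 1)], normalised to vanish at [+oo]; the subtracted constant
    cancels in the differences that form [G]. *)
Definition ln_den b q (x : R) := ln (1 + q * expR (- (b * x))).

Lemma is_derive_ln_den b q x : 0 < b -> 0 < q ->
  is_derive x (1 : R) (ln_den b q) (b / 2 * (nu b q x - 1)).
Proof.
move=> b0 q0; have dE := is_derive_expRN b x.
have d0 := nu_den_gt0 b x q0.
pose h y : R := 1 + q * expR (- (b * y)).
have dh : is_derive x 1 h (q * (- b * expR (- (b * x)))).
  by rewrite -[X in is_derive _ _ _ X]add0r; exact: is_deriveD.
have dl : is_derive (h x) 1 (@ln R) (h x)^-1 by exact: is_derive1_ln.
rewrite -[ln_den b q]/(@ln R \o h); apply: is_derive_eq.
by rewrite /h /nu /GRing.scale/=; field; rewrite gt_eqF.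
Qed.

Lemma cvg_ln_den b q : 0 < b -> 0 < q -> ln_den b q x @[x --> +oo] --> (0 : R).
Proof.
move=> b0 q0; have d1 : 1 + q * expR (- (b * x)) @[x --> +oo] --> (1 : R).
  rewrite -[X in _ --> X]addr0 -[X in _ + X](mulr0 q).
  apply: cvgD; first exact: cvg_cst.
  by apply: cvgM; [exact: cvg_cst|exact: cvg_expRNy].
rewrite -(@ln1 R) /ln_den; apply: (continuous_cvg _ _ d1).
exact: continuous_ln.
Qed.

Lemma nu_shift b q x c : nu b q (x + c) = nu b (q * expR (- (b * c))) x.
Proof.
rewrite /nu (_ : - (b * (x + c)) = - (b * c) - b * x); last by ring.
by rewrite expRD mulrA.
Qed.

Lemma is_derive_scaled_pairs (c x : R) (f1 f2 f3 f4 : R -> R) (d1 d2 d3 d4 : R) :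
  is_derive x (1 : R) f1 d1 -> is_derive x (1 : R) f2 d2 ->
  is_derive x (1 : R) f3 d3 -> is_derive x (1 : R) f4 d4 ->
  is_derive x (1 : R) (fun y => c * ((f1 y - f2 y) + (f3 y - f4 y)))
    (c * ((d1 - d2) + (d3 - d4))).
Proof.
by move=> ? ? ? ?; apply: is_deriveZ; apply: is_deriveD; exact: is_deriveB.
Qed.

(* [nu b q = 1 + (2 / b) * (ln_den b q)^`()], and shifting the argument of [nu] by
   [1] or [-1] multiplies [q] by [expR (- b)] or [expR b]. *)
Definition Psi_primitive b q (x : R) :=
  (4 * b)^-1 * ((ln_den b (q * expR (- b)) x - ln_den b (q * expR b) x)
                + (ln_den b (q^-1 * expR (- b)) x - ln_den b (q^-1 * expR b) x)).

Lemma is_derive_Psi_primitive b q x : 0 < b -> 0 < q ->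
  is_derive x (1 : R) (Psi_primitive b q) (Psi b q x).
Proof.
move=> b0 q0; have e0 := expR_gt0 b; have e'0 := expR_gt0 (- b).
have qV0 : 0 < q^-1 by rewrite invr_gt0.
have d1 := is_derive_ln_den x b0 (mulr_gt0 q0 e0).
have d2 := is_derive_ln_den x b0 (mulr_gt0 q0 e'0).
have d3 := is_derive_ln_den x b0 (mulr_gt0 qV0 e0).
have d4 := is_derive_ln_den x b0 (mulr_gt0 qV0 e'0).
apply: (@is_derive_eq _ _ _ _ _ _ _ _ (is_derive_scaled_pairs _ d2 d1 d4 d3)).
rewrite /Psi /G !nu_shift mulr1 mulrN1 opprK.
by field; rewrite gt_eqF.
Qed.

(** Since [1 + q e^(-b) = q e^(-b) (1 + q^-1 e^b)], and likewise with [q^-1] for [q], the product of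
    the two quotients under the logarithm is [e^(-2b)], independent of [q]. *)
Lemma Psi_primitive0 b q : 0 < b -> 0 < q -> Psi_primitive b q 0 = - 2^-1.
Proof.
move=> b0 q0; rewrite /Psi_primitive /ln_den mulr0 oppr0 expR0 !mulr1.
have e0 := expR_gt0 b; have e'0 := expR_gt0 (- b).
have p1 := mulr_gt0 q0 e0; have p2 := mulr_gt0 q0 e'0.
have p3 : 0 < q^-1 * expR b by rewrite mulr_gt0 ?invr_gt0.
have p4 : 0 < q^-1 * expR (- b) by rewrite mulr_gt0 ?invr_gt0.
rewrite -!ln_div ?posrE ?addr_gt0// -lnM ?posrE ?divr_gt0 ?addr_gt0//.
have -> : (1 + q * expR (- b)) / (1 + q * expR b) *
    ((1 + q^-1 * expR (- b)) / (1 + q^-1 * expR b)) = expR (- b - b).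
  rewrite expRD expRN; field.
  by rewrite !gt_eqF// ?addr_gt0// ?mulr_gt0.
by rewrite expRK; field; rewrite gt_eqF.
Qed.

Lemma cvg_Psi_primitive b q : 0 < b -> 0 < q ->
  Psi_primitive b q x @[x --> +oo] --> (0 : R).
Proof.
move=> b0 q0; have e0 := expR_gt0 b; have e'0 := expR_gt0 (- b).
have qV0 : 0 < q^-1 by rewrite invr_gt0.
rewrite -[X in _ --> X](mulr0 (4 * b)^-1) -[X in _ * X](addr0 0).
rewrite -[X in X + _](subrr 0) -[X in _ + X](subrr 0).
apply: cvgM; first exact: cvg_cst.
by apply: cvgD; apply: cvgB; apply: cvg_ln_den => //; exact: mulr_gt0.
Qed.

Lemma integral_Psi_half b q : 0 < b -> 0 < q ->
  (\int[mu]_(x in `[0%R, +oo[) (Psi b q x)%:E = (2^-1 : R)%:E)%E.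
Proof.
move=> b0 q0; have dF x := is_derive_Psi_primitive x b0 q0.
rewrite (ge0_integral_primitive_y _ _ dF (l := 0)).
- by rewrite Psi_primitive0// opprK add0r.
- by move=> x _; rewrite Psi_ge0// ltW.
- exact: continuous_Psi.
- exact: cvg_Psi_primitive.
Qed.

End kernel_mass.

(** * Reflections of the line and integrals of even functions *)

Section reflection.
Context {R : realType}.
Local Notation mu := (@lebesgue_measure R).

Lemma measurable_fun_reflect (a : R) :
  measurable_fun [set: measurableTypeR R] ((fun v => a - v) : _ -> measurableTypeR R).
Proof. exact: measurable_funB. Qed.

(** Lebesgue measure is determined by its values on the intervals []c, d]]; these pull back to [[a -
    d, a - c[], of the same length. *)
Lemma lebesgue_measure_reflect (a : R) (A : set R) : measurable A ->
  pushforward mu ((fun v => a - v) : _ -> measurableTypeR R) A = mu A.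
Proof.
have mr := measurable_fun_reflect a.
move=> mA; apply/esym/lebesgue_measure_unique => //= _ [[c d]] _ <-.
rewrite /pushforward (_ : _ @^-1` _ = `[a - d, a - c[%classic); last first.
  by apply/seteqP; split => v /=; rewrite !in_itv/= => /andP[? ?]; apply/andP; split; lra.
rewrite !lebesgue_measure_itv/= !lte_fin ltrD2l ltrN2.
by case: ifP => // _; rewrite -!EFinB; congr EFin; ring.
Qed.

Lemma ge0_integral_reflect (f : R -> R) (a : R) :
  measurable_fun [set: R] f -> (forall x, 0 <= f x) ->
  (\int[mu]_v (f (a - v))%:E = \int[mu]_v (f v)%:E)%E.
Proof.
move=> mf f0; have mr := measurable_fun_reflect a.
have -> : (\int[mu]_v (f v)%:E =
   \int[pushforward mu ((fun v => a - v)%R : _ -> measurableTypeR R)]_v (f v)%:E)%E.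
  by apply: eq_measure_integral => //= A mA _; exact/esym/lebesgue_measure_reflect.
rewrite ge0_integral_pushforward//; first exact/measurable_EFinP.
by move=> y _; rewrite lee_fin.
Qed.

Lemma ge0_integral_even (f : R -> R) :
  measurable_fun [set: R] f -> (forall x, 0 <= f x) -> (forall x, f (- x) = f x) ->
  (\int[mu]_v (f v)%:E = 2%:E * \int[mu]_(v in `[0%R, +oo[) (f v)%:E)%E.
Proof.
move=> mf f0 fe; have mEf : measurable_fun [set: R] (EFin \o f) by exact/measurable_EFinP.
rewrite -(setUv [set` `[0%R, +oo[]) ge0_integral_setU//=; last 4 first.
- exact: measurableC.
- exact: measurable_funS mEf.
- by move=> x _; rewrite lee_fin.
- exact/disj_setPCl.
rewrite mule_natl mule2n; congr (_ + _)%E; rewrite setCitvr.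
(* The complement is []-oo, 0[]; the null point 0 is added so that the substitution of [- v] for [v]
   maps it onto [[0, +oo[]. *)
rewrite integral_itv_bndo_bndc; last exact: measurable_funS mEf.
have /= -> := ge0_integration_by_substitution0 mEf; last by move=> r; rewrite lee_fin.
by under [RHS]eq_integral do rewrite fe.
Qed.

End reflection.

(** * Total mass, moments and tails of the kernel *)

Section moments.
Context {R : realType}.
Implicit Types (b q x y a T : R).
Local Notation mu := (@lebesgue_measure R).

Lemma measurable_Psi b q : 0 < q -> measurable_fun [set: R] (Psi b q).
Proof. by move=> q0; apply: continuous_measurable_fun; exact: continuous_Psi. Qed.

Lemma integral_Psi b q a : 0 < b -> 0 < q ->
  (\int[mu]_v (Psi b q (a - v))%:E = 1)%E.
Proof.
move=> b0 q0; have mP := measurable_Psi b q0.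
have P0 x : 0 <= Psi b q x by rewrite Psi_ge0// ltW.
rewrite (ge0_integral_reflect a mP P0) (ge0_integral_even mP P0); last first.
  by move=> x; rewrite Psi_even.
by rewrite integral_Psi_half// -EFinM divff.
Qed.

Lemma measurable_normX k : measurable_fun [set: R] (fun x : R => `|x| ^+ k).
Proof. by apply: measurable_funX; exact: normr_measurable. Qed.

Lemma measurable_exprn_expR b k :
  measurable_fun [set: R] (fun x => b * (x ^+ k * expR (- (b * x)))).
Proof.
apply: continuous_measurable_fun => x; apply: cvgM; first exact: cvg_cst.
by apply: cvgM; [exact: exprn_continuous|exact: continuous_expRN].
Qed.

(** The factor 2 gained by folding the line at 0 cancels the [2^-1] of [Psi_le]; what remains is the
    gamma integral. *)
Lemma integral_moment_Psi_le b q a k : 0 < b -> 0 < q ->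
  (\int[mu]_v (`|a - v| ^+ k * Psi b q (a - v))%:E
    <= ((q + q^-1) * (expR b * k`!%:R / b ^+ k))%:E)%E.
Proof.
move=> b0 q0; pose f x := `|x| ^+ k * Psi b q x.
have mf : measurable_fun [set: R] f.
  by apply: measurable_funM; [exact: measurable_normX|exact: measurable_Psi].
have f0 x : 0 <= f x by rewrite mulr_ge0// Psi_ge0// ltW.
have K0 : 0 <= 2^-1 * (q + q^-1) * expR b.
  by rewrite !mulr_ge0 ?addr_ge0 ?expR_ge0 ?invr_ge0 ?(ltW q0).
rewrite (ge0_integral_reflect a mf f0) (ge0_integral_even mf f0); last first.
  by move=> x; rewrite /f normrN Psi_even.
apply: (@le_trans _ _ (2%:E * \int[mu]_(x in `[0%R, +oo[)
   ((2^-1 * (q + q^-1) * expR b)%:E * (b * (x ^+ k * expR (- (b * x))))%:E))%E).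
  rewrite lee_pmul2l//; apply: ge0_le_integral => //=.
  - by move=> x _; rewrite lee_fin.
  - exact/measurable_EFinP/measurable_funTS.
  - apply/measurable_EFinP/measurable_funTS; apply: measurable_funM => //.
    exact: measurable_exprn_expR.
  - move=> x; rewrite in_itv/= andbT => x0; rewrite lee_fin /f ger0_norm//.
    have := Psi_le x (ltW b0) q0; rewrite (ger0_norm x0) => H.
    apply: le_trans (ler_wpM2l (exprn_ge0 k x0) H) _.
    by rewrite le_eqVlt; apply/orP; left; apply/eqP; ring.
rewrite ge0_integralZl_EFin//; last 2 first.
- move=> x; rewrite /= in_itv/= andbT => x0.
  by rewrite lee_fin !mulr_ge0 ?exprn_ge0 ?expR_ge0// ltW.
- by apply/measurable_EFinP/measurable_funTS; exact: measurable_exprn_expR.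
rewrite integral_exprn_expR// -!EFinM lee_fin le_eqVlt; apply/orP; left.
by apply/eqP; field; rewrite ?gt_eqF// ?exprn_gt0.
Qed.

(** Used through its indicator, so that a single dominating function on the whole line covers near
    and far nodes. *)
Definition far T : set R := [set x | T <= `|x|].

Lemma measurable_indic_far T : measurable_fun [set: R] (\1_(far T) : R -> R).
Proof.
apply/measurable_indicP; rewrite /far -[X in measurable X]setTI.
have -> : [set x : R | T <= `|x|] = (@Num.norm R R) @^-1` `[T, +oo[.
  by apply/seteqP; split => x /=; rewrite in_itv/= andbT.
exact: normr_measurable.
Qed.

(** The summand 1 integrates to [expR (- (b * T))], which is more than is needed. For the power,
    half of the exponent is frozen at [T] and the other half gives a gamma integral of rate
    [b / 2]. *)
Lemma integral_tail_Psi_le b q a T k : 0 < b -> 0 < q -> 0 <= T ->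
  (\int[mu]_v (\1_(far T) (a - v) * (1 + `|a - v| ^+ k) * Psi b q (a - v))%:E
    <= ((q + q^-1) * expR b * expR (- (b * T / 2))
        * (1 + 2 ^+ k.+1 * k`!%:R / b ^+ k))%:E)%E.
Proof.
move=> b0 q0 T0; pose f x := \1_(far T) x * (1 + `|x| ^+ k) * Psi b q x.
have mf : measurable_fun [set: R] f.
  apply: measurable_funM; last exact: measurable_Psi.
  apply: measurable_funM; first exact: measurable_indic_far.
  by apply: measurable_funD => //; exact: measurable_normX.
have f0 x : 0 <= f x.
  by apply: mulr_ge0; [rewrite mulr_ge0 ?addr_ge0|rewrite Psi_ge0 ?ltW].
have K0 : 0 <= 2^-1 * (q + q^-1) * expR b.
  by rewrite !mulr_ge0 ?addr_ge0 ?expR_ge0 ?invr_ge0 ?(ltW q0).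
have b20 : 0 < b / 2 by rewrite divr_gt0.
pose c := 2^-1 * (q + q^-1) * expR b.
pose e := expR (- (b * T / 2)).
(* [g1] serves the summand 1 and [2 * e * g2] serves the power; the 2 compensates for [b / 2] in
   front of [g2]. *)
pose g1 x := b * expR (- (b * x)).
pose g2 x := (b / 2) * (x ^+ k * expR (- (b / 2 * x))).
have mg1 : measurable_fun [set: R] g1.
  have := measurable_exprn_expR b 0; apply: eq_measurable_fun => x _.
  by rewrite expr0 mul1r.
have mg2 : measurable_fun [set: R] g2 by exact: measurable_exprn_expR.
have g10 x : 0 <= g1 x by rewrite mulr_ge0 ?expR_ge0 ?(ltW b0).
have g20 x : 0 <= x -> 0 <= g2 x.
  by move=> x0; rewrite !mulr_ge0 ?exprn_ge0 ?expR_ge0 ?(ltW b0).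
have e0 : 0 <= 2 * e by rewrite mulr_ge0 ?expR_ge0.
rewrite (ge0_integral_reflect a mf f0) (ge0_integral_even mf f0); last first.
  move=> x; rewrite /f normrN Psi_even//; congr (_ * _ * _); rewrite !indicE.
  by congr (_%:R); congr nat_of_bool; apply/idP/idP; rewrite !inE /far/= normrN.
have -> : (\int[mu]_(x in `[0%R, +oo[) (f x)%:E
    = \int[mu]_(x in `[T, +oo[) (f x)%:E)%E.
  rewrite integral_mkcond [RHS]integral_mkcond; apply: eq_integral => x _.
  rewrite !patchE !mem_setE !in_itv/= !andbT.
  have [x0|x0] := leP 0 x; have [xT|xT] := leP T x => //.
    by rewrite /f indicE memNset ?mul0r// /far/= ger0_norm//; apply/negP; rewrite -ltNge.
  by have := lt_le_trans x0 (le_trans T0 xT); rewrite ltxx.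
(* On [T <= x], [expR (- b x) <= e * expR (- b x / 2)]. *)
apply: (@le_trans _ _ (2%:E * \int[mu]_(x in `[T, +oo[)
   (c%:E * ((g1 x)%:E + (2 * e)%:E * (g2 x)%:E)))%E).
  rewrite lee_pmul2l//; apply: ge0_le_integral => //=.
  - by move=> x _; rewrite lee_fin.
  - exact/measurable_EFinP/measurable_funTS.
  - apply/measurable_EFinP/measurable_funTS; apply: measurable_funM => //.
    by apply: measurable_funD => //; exact: measurable_funM.
  - move=> x; rewrite in_itv/= andbT => xT; rewrite lee_fin.
    have x0 := le_trans T0 xT.
    rewrite /f indicE mem_set ?mul1r /far/= ger0_norm//.
    have := Psi_le x (ltW b0) q0; rewrite (ger0_norm x0) => H.
    apply: le_trans (ler_wpM2l _ H) _; first by rewrite addr_ge0// exprn_ge0.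
    rewrite mulrCA ler_wpM2l// mulrDl mul1r lerD2l.
    have -> : - (b * x) = - (b / 2 * x) - (b / 2 * x) by field.
    have ee : expR (- (b / 2 * x)) <= e.
      rewrite ler_expR lerN2 mulrAC ler_wpM2l//.
      by rewrite ltW.
    rewrite expRD (_ : 2 * e * g2 x = x ^+ k * b * expR (- (b / 2 * x)) * e); last first.
      by rewrite /g2; field.
    rewrite !mulrA ler_wpM2l// !mulr_ge0 ?exprn_ge0 ?expR_ge0//.
    exact: ltW.
rewrite ge0_integralZl_EFin//; last 2 first.
- move=> x; rewrite /= in_itv/= andbT => xT.
  by rewrite lee_fin addr_ge0// mulr_ge0// g20// (le_trans T0).
- apply/measurable_EFinP/measurable_funTS.
  by apply: measurable_funD => //; exact: measurable_funM.
have mg2T : measurable_fun `[T, +oo[ (EFin \o g2).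
  exact/measurable_EFinP/measurable_funTS.
have g20T x : x \in `[T, +oo[ -> (0 <= (g2 x)%:E)%E.
  by rewrite in_itv/= andbT => xT; rewrite lee_fin g20// (le_trans T0).
rewrite ge0_integralD//=; last 4 first.
- by move=> x _; rewrite lee_fin.
- exact/measurable_EFinP/measurable_funTS.
- by move=> x xT; rewrite mule_ge0 ?lee_fin// -lee_fin g20T.
- exact: emeasurable_funM.
rewrite ge0_integralZl_EFin// integral_expR_tail//.
(* The domain can be enlarged to [[0, +oo[] without loss of decay, since the factor [e] has already
   been extracted. *)
have I2 : (\int[mu]_(x in `[T, +oo[) (g2 x)%:E <= (k`!%:R / (b / 2) ^+ k)%:E)%E.
  rewrite -integral_exprn_expR//; apply: ge0_subset_integral => //=.
  - exact/measurable_EFinP/measurable_funTS.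
  - by move=> x; rewrite in_itv/= andbT => x0; rewrite lee_fin; exact: g20.
  - by move=> x /=; rewrite !in_itv/= !andbT; exact: le_trans.
apply: (@le_trans _ _
    (2%:E * (c%:E * (e%:E + (2 * e)%:E * (k`!%:R / (b / 2) ^+ k)%:E)))%E).
  rewrite lee_pmul2l//; apply: lee_wpmul2l => //.
  apply: leeD; last exact: lee_wpmul2l.
  by rewrite lee_fin ler_expR lerN2 ler_pdivrMr// ler_peMr ?ler1n// mulr_ge0// ltW.
rewrite -[leLHS]/(2 * (c * (e + 2 * e * (k`!%:R / (b / 2) ^+ k))))%:E.
rewrite lee_fin le_eqVlt; apply/orP; left.
by apply/eqP; rewrite /c -/e expr_div_n exprS; field; rewrite ?gt_eqF// ?exprn_gt0.
Qed.

End moments.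

(** * Measurability, domination and linearity of the operator *)

Section operator.
Context {R : realType}.
Variables (b q : R) (n : nat).
Hypotheses (b0 : 0 < b) (q0 : 0 < q) (n0 : (0 < n)%N).
Implicit Types (f g : R -> R) (v x c C : R).
Local Notation mu := (@lebesgue_measure R).

Let nR : 0 < n%:R :> R. Proof. by rewrite ltr0n. Qed.
Let mD : measurable `[0, n%:R^-1 : R]. Proof. exact: measurable_itv. Qed.

Definition cell g v : \bar R :=
  (\int[mu]_(h in `[0%R, n%:R^-1%R]) (g (h + v / n%:R)%R)%:E)%E.

Lemma integrable_cell g v : continuous g ->
  mu.-integrable `[0, n%:R^-1] (fun h => (g (h + v / n%:R))%:E).
Proof.
move=> cg; apply: (@continuous_compact_integrable _ (fun h => g (h + v / n%:R))).
  exact: segment_compact.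
apply: continuous_subspaceT => h.
apply: (@continuous_comp _ _ _ (fun h => h + v / n%:R) g); last exact: cg.
by apply: cvgD; [exact: cvg_id|exact: cvg_cst].
Qed.

Lemma cell_fin_num g v : continuous g -> cell g v \is a fin_num.
Proof. by move=> cg; apply: integrable_fin_num => //; exact: integrable_cell. Qed.

Lemma cell_linear f g c v : continuous f -> continuous g ->
  cell (fun t => f t + c * g t) v = (cell f v + c%:E * cell g v)%E.
Proof.
move=> cf cg; rewrite /cell -integralZl//; last exact: integrable_cell.
rewrite -integralD//; [exact: integrable_cell|].
by apply: integrableZl => //; exact: integrable_cell.
Qed.

Lemma cell_le g v C : continuous g ->
  (forall h, 0 <= h <= n%:R^-1 -> `|g (h + v / n%:R)| <= C) ->
  (`|cell g v| <= (n%:R^-1 * C)%:E)%E.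
Proof.
move=> cg gC; have /integrableP[mg _] := integrable_cell v cg.
apply: (le_trans (le_abse_integral mu mD mg)).
have C0 : 0 <= C.
  by apply: le_trans (gC 0 _); rewrite ?lexx ?invr_ge0 ?normr_ge0 // ltW.
apply: (@le_trans _ _ (\int[mu]_(h in `[0%R, n%:R^-1%R]) (cst C%:E) h)%E).
  apply: ge0_le_integral => //.
  exact: measurableT_comp.
rewrite integral_cst//= lebesgue_measure_itv/= lte_fin invr_gt0 nR.
by rewrite -EFinB -EFinM subr0 mulrC.
Qed.

(** With the interval turned into an indicator, the integrand is jointly measurable in [(v, h)].
    Tonelli asks for nonnegative functions, hence the split into positive and negative parts. *)
Lemma measurable_cell g : continuous g -> measurable_fun [set: R] (cell g).
Proof.
move=> cg.
pose k (p : R * R) : \bar R := (g (p.2 + p.1 / n%:R) * \1_(`[0, n%:R^-1]) p.2)%:E.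
have mk : measurable_fun [set: R * R] k.
  apply/measurable_EFinP; apply: measurable_funM.
    apply: measurableT_comp; first exact: continuous_measurable_fun.
    apply: measurable_funD; first exact: measurable_snd.
    by apply: measurable_funM => //; exact: measurable_fst.
  apply: measurableT_comp; last exact: measurable_snd.
  exact: measurable_indic.
have -> : cell g = (fun v => fubini_F mu k^\+ v - fubini_F mu k^\- v)%E.
  apply/funext => v; rewrite /cell integral_mkcond.
  rewrite [LHS](_ : _ = \int[mu]_h k (v, h))%E; last first.
    apply: eq_integral => h _; rewrite /k patchE indicE /=.
    by case: ifP; rewrite ?mulr1 ?mulr0.
  rewrite [LHS]integralE /fubini_F.
  under eq_integral do rewrite funepos_comp/=.
  by under [X in (_ - X)%E = _]eq_integral do rewrite funeneg_comp/=.
apply: emeasurable_funB; apply: measurable_fun_fubini_tonelli_F => //.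
- exact: measurable_funepos.
- exact: measurable_funeneg.
Qed.

(** [Bstar] is defined for every function, convergent or not; this is the condition under which it
    may be added and scaled. *)
Definition Bstar_integrable g x :=
  mu.-integrable [set: R] (fun v => cell g v * (Psi b q (n%:R * x - v))%:E)%E.

Lemma BstarE g x : Bstar b q n g x =
  ((n%:R)%:E * \int[mu]_v (cell g v * (Psi b q (n%:R * x - v))%:E))%E.
Proof. by []. Qed.

Lemma measurable_Psi_reflect x :
  measurable_fun [set: R] (fun v => Psi b q (n%:R * x - v)).
Proof.
apply: measurableT_comp; first exact: measurable_Psi.
exact: measurable_funB.
Qed.

Lemma measurable_Bstar_integrand g x : continuous g ->
  measurable_fun [set: R] (fun v => cell g v * (Psi b q (n%:R * x - v))%:E)%E.
Proof.
move=> cg; apply: emeasurable_funM; first exact: measurable_cell.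
by apply/measurable_EFinP; exact: measurable_Psi_reflect.
Qed.

Section domination.
Variables (g : R -> R) (x : R) (B : R -> R).
Hypotheses (cg : continuous g) (mB : measurable_fun [set: R] B).
Hypothesis gB : forall v h, 0 <= h <= n%:R^-1 ->
  `|g (h + v / n%:R)| <= B (n%:R * x - v).

Let B0 u : 0 <= B u.
Proof.
(* The node [h = 0] with [v = n x - u] exhibits [B u] as a bound of an absolute value. *)
have := @gB (n%:R * x - u) 0; rewrite subKr lexx invr_ge0 ltW// => /(_ isT).
exact: le_trans.
Qed.

Let P0 u : 0 <= Psi b q u. Proof. by rewrite Psi_ge0// ltW. Qed.

Let integrand_le v : (`|cell g v * (Psi b q (n%:R * x - v))%:E|
  <= (n%:R^-1)%:E * (B (n%:R * x - v) * Psi b q (n%:R * x - v))%:E)%E.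
Proof.
rewrite abseM [X in (_ * X <= _)%E]gee0_abs ?lee_fin// (EFinM (B _)) muleA.
rewrite lee_wpmul2r ?lee_fin//.
by rewrite -EFinM; apply: cell_le => // h; exact: gB.
Qed.

Let mBP : measurable_fun [set: R]
  (fun v => (B (n%:R * x - v) * Psi b q (n%:R * x - v))%:E).
Proof.
apply/measurable_EFinP; apply: measurable_funM; last exact: measurable_Psi_reflect.
by apply: measurableT_comp => //; exact: measurable_funB.
Qed.

Let abs_integral_le : (\int[mu]_v `|cell g v * (Psi b q (n%:R * x - v))%:E|
  <= (n%:R^-1)%:E * \int[mu]_v (B (n%:R * x - v) * Psi b q (n%:R * x - v))%:E)%E.
Proof.
rewrite -ge0_integralZl_EFin ?invr_ge0 ?(ltW nR)//; last first.
  by move=> v _; rewrite lee_fin mulr_ge0.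
apply: ge0_le_integral => //.
- by apply: measurableT_comp => //; exact: measurable_Bstar_integrand.
- exact: emeasurable_funM.
Qed.

Lemma dominated_Bstar_integrable :
  (\int[mu]_v (B (n%:R * x - v) * Psi b q (n%:R * x - v))%:E < +oo)%E ->
  Bstar_integrable g x.
Proof.
move=> fin; apply/integrableP; split; first exact: measurable_Bstar_integrand.
apply: le_lt_trans abs_integral_le _.
apply: lte_mul_pinfty => //; by rewrite lee_fin invr_ge0 ltW.
Qed.

(** The factor [n] of the operator cancels the length [n%:R^-1] of a cell, so the bound is the plain
    average of [B] against the kernel. *)
Lemma Bstar_le : (`|Bstar b q n g x|
  <= \int[mu]_v (B (n%:R * x - v) * Psi b q (n%:R * x - v))%:E)%E.
Proof.
rewrite BstarE abseM [X in (X * _ <= _)%E]gee0_abs ?lee_fin ?(ltW nR)//.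
have -> : (\int[mu]_v (B (n%:R * x - v) * Psi b q (n%:R * x - v))%:E
  = n%:R%:E * ((n%:R^-1)%:E * \int[mu]_v (B (n%:R * x - v) * Psi b q (n%:R * x - v))%:E))%E.
  by rewrite muleA -EFinM divff ?mul1e// gt_eqF.
apply: lee_wpmul2l; first by rewrite lee_fin ltW.
apply: le_trans abs_integral_le.
by apply: le_abse_integral => //; exact: measurable_Bstar_integrand.
Qed.

End domination.

Lemma Bstar_fin_num g x : Bstar_integrable g x -> Bstar b q n g x \is a fin_num.
Proof.
by move=> ig; rewrite BstarE fin_numM//; exact: integrable_fin_num.
Qed.

Lemma Bstar_linear f g c x : continuous f -> continuous g ->
  Bstar_integrable f x -> Bstar_integrable g x ->
  Bstar_integrable (fun t => f t + c * g t) x /\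
  Bstar b q n (fun t => f t + c * g t) x
    = (Bstar b q n f x + c%:E * Bstar b q n g x)%E.
Proof.
move=> cf cg iF iG.
have E : (fun v => cell (fun t => f t + c * g t)%R v * (Psi b q (n%:R * x - v))%:E)%E
   = (fun v => cell f v * (Psi b q (n%:R * x - v))%:E
       + c%:E * (cell g v * (Psi b q (n%:R * x - v))%:E))%E.
  apply/funext => v; rewrite cell_linear// muleDl ?muleA//.
  (* Distributivity in [\bar R] must exclude [+oo - oo]; continuity makes the cells finite. *)
  by rewrite fin_num_adde_defl// fin_numM// cell_fin_num.
have iG' := integrableZl measurableT c iG.
split; first by rewrite /Bstar_integrable E; exact: integrableD.
rewrite !BstarE E integralD// integralZl// muleDr//; last first.
  by rewrite fin_num_adde_defl// fin_numM//; exact: integrable_fin_num.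
by rewrite muleCA.
Qed.

Lemma Bstar_cst c x : Bstar_integrable (cst c) x /\ Bstar b q n (cst c) x = c%:E.
Proof.
have cE v : cell (cst c) v = (c * n%:R^-1)%:E.
  rewrite -[LHS]/(\int[mu]_(h in `[0%R, n%:R^-1%R]) cst c%:E h)%E.
  rewrite integral_cst//= lebesgue_measure_itv/= lte_fin invr_gt0 nR.
  by rewrite -EFinB -EFinM subr0.
have mP := measurable_Psi_reflect x.
have iP : mu.-integrable [set: R] (fun v => (Psi b q (n%:R * x - v))%:E).
  apply/integrableP; split; first exact/measurable_EFinP.
  under eq_integral do rewrite gee0_abs ?lee_fin ?Psi_ge0 ?ltW//.
  by rewrite integral_Psi// ltry.
have E : (fun v => cell (cst c) v * (Psi b q (n%:R * x - v))%:E)%E =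
  (fun v => (c * n%:R^-1)%:E * (Psi b q (n%:R * x - v))%:E)%E.
  by apply/funext => v; rewrite cE.
split; first by rewrite /Bstar_integrable E; exact: integrableZl.
rewrite BstarE E integralZl// integral_Psi// mule1 -EFinM mulrCA divff ?mulr1//.
by rewrite gt_eqF.
Qed.

End operator.

(** * Taylor's formula with the oscillation of the last derivative *)

Section taylor.
Context {R : realType}.
Implicit Types (f : R -> R) (x d C s : R) (N : nat).

Lemma ge0_derive_le (h dh : R -> R) s : 0 <= s ->
  (forall u, is_derive u (1 : R) h (dh u)) ->
  (forall u, 0 <= u <= s -> 0 <= dh u) -> h 0 <= h s.
Proof.
move=> s0 dhu dh0; have ch : continuous h.
  move=> u; apply/differentiable_continuous/derivable1_diffP.
  exact: (@ex_derive _ _ _ _ _ _ _ (dhu u)).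
have [u] := MVT_segment s0 (fun u _ => dhu u) (continuous_subspaceT ch).
rewrite in_itv/= => us hE.
by rewrite -subr_ge0 hE subr0 mulr_ge0// dh0.
Qed.

Lemma is_derive_mulr d s : is_derive s (1 : R) (fun u => u * d) d.
Proof.
rewrite (_ : (fun u => u * d) = d *: (@id R)); last first.
  by apply/funext => u /=; rewrite mulrC.
by apply: is_derive_eq; rewrite /GRing.scale/= mulr1.
Qed.

Lemma is_derive_poly_segment (c : nat -> R) d s N :
  is_derive s (1 : R) (fun u => \sum_(k < N) c k * (u * d) ^+ k)
    (\sum_(k < N) c k * (k%:R * (s * d) ^+ k.-1 * d)).
Proof.
elim: N => [|N IH].
  rewrite big_ord0 (_ : (fun _ => _) = cst 0); last first.
    by apply/funext => u; rewrite big_ord0.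
  exact: is_derive_cst.
rewrite big_ord_recr/= (_ : (fun _ => _) =
   (fun u => \sum_(k < N) c k * (u * d) ^+ k) + (fun u => c N * (u * d) ^+ N)); last first.
  by apply/funext => u; rewrite big_ord_recr.
apply: is_deriveD; apply: is_deriveZ.
have dX := is_derive_exprn N (s * d).
have dl := is_derive_mulr d s.
rewrite -[X in is_derive _ _ X _]/((fun y => y ^+ N) \o (fun u => u * d)).
by apply: is_derive_eq; rewrite /GRing.scale/= mulrC.
Qed.

(* Parametrizing the segment from [x] to [x + d] treats both signs of [d] at once
   and lets the induction apply to [f^`()] on the same segment. *)
Lemma taylor_segment N f x d C :
  (forall k y, (k < N)%N -> derivable (derive1n k f) y 1) ->
  (forall s, 0 <= s <= 1 -> `|derive1n N f (x + s * d) - derive1n N f x| <= C) ->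
  forall s, 0 <= s <= 1 ->
  `|f (x + s * d) - \sum_(k < N.+1) derive1n k f x / k`!%:R * (s * d) ^+ k|
    <= C * (s * `|d|) ^+ N / N`!%:R.
Proof.
elim: N f => [|N IH] f df fC s /andP[s0 s1].
  rewrite big_ord_recr big_ord0/= add0r !expr0 divr1 !mulr1 divr1.
  by rewrite fC// s0.
have dfE k y : derivable (derive1n k f) y 1 ->
    is_derive y 1 (derive1n k f) (derive1n k.+1 f y).
  by move=> dk; rewrite derive1nS derive1E; exact: derivableP.
have {}IH u : 0 <= u <= 1 ->
    `|derive1n 1 f (x + u * d)
      - \sum_(k < N.+1) derive1n k.+1 f x / k`!%:R * (u * d) ^+ k|
    <= C * (u * `|d|) ^+ N / N`!%:R.
  move=> u01; under eq_bigr do rewrite derive1Sn.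
  apply: IH => //.
  - by move=> k y kN; rewrite -derive1Sn; exact: df.
  - by move=> v v01; rewrite -!derive1Sn; exact: fC.
pose r u := f (x + u * d) - \sum_(k < N.+2) derive1n k f x / k`!%:R * (u * d) ^+ k.
pose dr u := (derive1n 1 f (x + u * d)
      - \sum_(k < N.+1) derive1n k.+1 f x / k`!%:R * (u * d) ^+ k) * d.
have rE (u : R) : is_derive u (1 : R) r (dr u).
  have dl : is_derive u (1 : R) (fun v => x + v * d) d.
    rewrite -[X in is_derive _ _ _ X]add0r; apply: is_deriveD.
    exact: is_derive_mulr.
  have dfu : is_derive (x + u * d) 1 f (derive1n 1 f (x + u * d)).
    exact: (dfE 0%N _ (df 0%N _ _)).
  have dfc : is_derive u 1 (f \o (fun v => x + v * d)) (derive1n 1 f (x + u * d) * d).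
    by apply: is_derive_eq; rewrite /GRing.scale/= mulrC.
  rewrite /dr mulrBl mulr_suml.
  have -> : \sum_(k < N.+1) derive1n k.+1 f x / k`!%:R * (u * d) ^+ k * d =
     \sum_(k < N.+2) derive1n k f x / k`!%:R * (k%:R * (u * d) ^+ k.-1 * d).
    rewrite [RHS]big_ord_recl/= mul0r mul0r mulr0 add0r; apply: eq_bigr => k _.
    rewrite /bump/= add1n factS natrM.
    have k0 : k.+1%:R != 0 :> R by rewrite pnatr_eq0.
    have f0 : k`!%:R != 0 :> R by rewrite pnatr_eq0 -lt0n fact_gt0.
    by move: (k.+1%:R) (k`!%:R) k0 f0 => a c a0 c0; field; rewrite a0 c0.
  exact: (is_deriveB dfc
    (is_derive_poly_segment (fun k => derive1n k f x / k`!%:R) d u N.+2)).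
have r0 : r 0 = 0.
  rewrite /r big_ord_recl/= !mul0r addr0 expr0 divr1 mulr1 big1 ?addr0 ?subrr//.
  by move=> k _; rewrite expr0n mulr0.
(* The claimed bound as a function of the parameter. It vanishes at 0 together with [r], and the
   bound of [dr] by [dm] makes [m + r] and [m - r] nondecreasing on [[0, s]]. *)
pose m u := C * `|d| ^+ N.+1 / N.+1`!%:R * u ^+ N.+1.
pose dm u := C * `|d| ^+ N.+1 / N`!%:R * u ^+ N.
have mE (u : R) : is_derive u (1 : R) m (dm u).
  have dX := is_derive_exprn N.+1 u.
  have -> : dm u = C * `|d| ^+ N.+1 / N.+1`!%:R * (N.+1%:R * u ^+ N).
    rewrite /dm factS natrM.
    have N0 : N.+1%:R != 0 :> R by rewrite pnatr_eq0.
    have f0 : N`!%:R != 0 :> R by rewrite pnatr_eq0 -lt0n fact_gt0.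
    by move: (N.+1%:R) (N`!%:R) N0 f0 => a c a0 c0; field; rewrite a0 c0.
  exact: is_deriveZ.
have m0 : m 0 = 0 by rewrite /m expr0n mulr0.
have drm (u : R) : 0 <= u <= s -> `|dr u| <= dm u.
  move=> /andP[u0 us]; rewrite normrM.
  have u1 : 0 <= u <= 1 by rewrite u0 (le_trans us).
  apply: le_trans (ler_wpM2r (normr_ge0 d) (IH u u1)) _.
  rewrite le_eqVlt; apply/orP; left; apply/eqP; rewrite /dm exprMn exprS; field.
  by rewrite !pnatr_eq0 -lt0n fact_gt0.
have -> : C * (s * `|d|) ^+ N.+1 / N.+1`!%:R = m s by rewrite /m exprMn; ring.
rewrite -/(r s) ler_norml; apply/andP; split.
- have : (m + r) 0 <= (m + r) s.
    apply: (@ge0_derive_le _ (fun u => dm u + dr u)) => // u us.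
    by have := drm u us; rewrite ler_norml => /andP[]; lra.
  have -> : (m + r) 0 = m 0 + r 0 by [].
  have -> : (m + r) s = m s + r s by [].
  by rewrite m0 r0; lra.
- have : (m - r) 0 <= (m - r) s.
    apply: (@ge0_derive_le _ (fun u => dm u - dr u)) => // u us.
    by have := drm u us; rewrite ler_norml => /andP[]; lra.
  have -> : (m - r) 0 = m 0 - r 0 by [].
  have -> : (m - r) s = m s - r s by [].
  by rewrite m0 r0; lra.
Qed.

Definition taylor_rest f x N t :=
  f t - \sum_(k < N.+1) derive1n k f x / k`!%:R * (t - x) ^+ k.

Lemma taylor_rest_le N f x t C :
  (forall k y, (k < N)%N -> derivable (derive1n k f) y 1) ->
  (forall y, `|y - x| <= `|t - x| -> `|derive1n N f y - derive1n N f x| <= C) ->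
  `|taylor_rest f x N t| <= C * `|t - x| ^+ N / N`!%:R.
Proof.
move=> df fC.
have H : forall s, 0 <= s <= 1 ->
    `|derive1n N f (x + s * (t - x)) - derive1n N f x| <= C.
  move=> s /andP[s0 s1]; apply: fC; rewrite addrAC subrr add0r normrM ger0_norm//.
  by rewrite ler_piMl.
have := taylor_segment df H (s := 1); rewrite ler01 lexx => /(_ isT).
by rewrite !mul1r (_ : x + (t - x) = t)//; ring.
Qed.

End taylor.

Section kernel_averages.
Context {R : realType}.
Variables (b q : R).
Hypotheses (b0 : 0 < b) (q0 : 0 < q).
Local Notation mu := (@lebesgue_measure R).

(** The constant part contributes exactly [A] because the kernel has mass 1. Both the moments and
    the Taylor rest are dominated in this form. *)
Lemma integral_affine_Psi_le (H : R -> R) (a A C M : R) :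
  measurable_fun [set: R] H -> (forall u, 0 <= H u) -> 0 <= A -> 0 <= C ->
  (\int[mu]_v (H (a - v) * Psi b q (a - v))%:E <= M%:E)%E ->
  (\int[mu]_v ((A + C * H (a - v)) * Psi b q (a - v))%:E <= (A + C * M)%:E)%E.
Proof.
move=> mH H0 A0 C0 HM.
have P0 u : 0 <= Psi b q u by rewrite Psi_ge0// ltW.
have mP : measurable_fun [set: R] (fun v => Psi b q (a - v)).
  by apply: measurableT_comp; [exact: measurable_Psi|exact: measurable_funB].
have mHa : measurable_fun [set: R] (fun v => H (a - v)).
  by apply: measurableT_comp => //; exact: measurable_funB.
have -> : (\int[mu]_v ((A + C * H (a - v)) * Psi b q (a - v))%:E =
  \int[mu]_v (A%:E * (Psi b q (a - v))%:E
    + C%:E * (H (a - v) * Psi b q (a - v))%:E))%E.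
  by apply: eq_integral => v _; rewrite -!EFinM -EFinD; congr EFin; ring.
have mEP : measurable_fun [set: R] (fun v => (Psi b q (a - v))%:E).
  exact/measurable_EFinP.
have mEHP : measurable_fun [set: R] (fun v => (H (a - v) * Psi b q (a - v))%:E).
  by apply/measurable_EFinP; exact: measurable_funM.
have HP0 v : (0 <= (H (a - v) * Psi b q (a - v))%:E)%E by rewrite lee_fin mulr_ge0.
rewrite ge0_integralD//; last 4 first.
- by move=> v _; rewrite mule_ge0 ?lee_fin.
- exact: emeasurable_funM.
- by move=> v _; rewrite mule_ge0.
- exact: emeasurable_funM.
rewrite !ge0_integralZl_EFin//; last by move=> v _; rewrite lee_fin.
rewrite integral_Psi// mule1 EFinD EFinM leeD2l//.
exact: lee_wpmul2l.
Qed.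

End kernel_averages.

Section cell_bounds.
Context {R : realType}.

Lemma exprD1_le (y : R) (k : nat) : 0 <= y ->
  (1 + y) ^+ k.+1 <= 2 ^+ k * (1 + y ^+ k.+1).
Proof.
move=> y0; elim: k => [|k IH]; first by rewrite expr0 mul1r !expr1.
rewrite exprSr; apply: (le_trans (ler_wpM2r _ IH)); first by rewrite addr_ge0.
rewrite [2 ^+ k.+1]exprSr -!mulrA ler_wpM2l ?exprn_ge0//.
(* Both factors have the same sign; expanded, this is [y + y^(k+1) <= 1 + y^(k+2)], the mixed terms
   of the product to be bounded. *)
have : 0 <= (1 - y) * (1 - y ^+ k.+1).
  have [y1|y1] := leP y 1; first by rewrite mulr_ge0// subr_ge0// exprn_ile1.
  by rewrite mulr_le0// subr_le0 ?(ltW y1)// exprn_ege1// ltW.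
by rewrite [y ^+ k.+2]exprSr; lra.
Qed.

Lemma cell_dist_le (n : nat) (x v h : R) : (0 < n)%N -> 0 <= h <= n%:R^-1 ->
  `|h + v / n%:R - x| <= (1 + `|n%:R * x - v|) / n%:R.
Proof.
move=> n0 /andP[h0 hn]; have nR : 0 < n%:R :> R by rewrite ltr0n.
have -> : h + v / n%:R - x = h - (n%:R * x - v) / n%:R by field; rewrite gt_eqF.
apply: le_trans (ler_normB _ _) _.
by rewrite ger0_norm// normrM normfV (gtr0_norm nR) mulrDl mul1r lerD2r.
Qed.

Lemma cell_dist_pow_le (n k : nat) (x v h : R) : (0 < n)%N -> (0 < k)%N ->
  0 <= h <= n%:R^-1 ->
  `|h + v / n%:R - x| ^+ k
    <= 2 ^+ k.-1 / n%:R ^+ k * (1 + `|n%:R * x - v| ^+ k).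
Proof.
case: k => // k n0 _ hn; have nR : 0 < n%:R :> R by rewrite ltr0n.
apply: (@le_trans _ _ (((1 + `|n%:R * x - v|) / n%:R) ^+ k.+1)).
  by rewrite lerXn2r ?nnegrE ?cell_dist_le// divr_ge0 ?addr_ge0// ltW.
rewrite expr_div_n ler_pdivrMr ?exprn_gt0//=.
by rewrite -mulrAC divfK ?gt_eqF ?exprn_gt0// exprD1_le.
Qed.

End cell_bounds.

(** * Action of the operator on monomials and on the Taylor rest *)

Section moments_of_operator.
Context {R : realType}.
Variables (b q : R) (n : nat).
Hypotheses (b0 : 0 < b) (q0 : 0 < q) (n0 : (0 < n)%N).
Implicit Types (x : R) (k : nat).
Local Notation mu := (@lebesgue_measure R).
Local Notation monomial x k := (fun t : R => (t - x) ^+ k).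

Lemma continuous_monomial x k : continuous (monomial x k).
Proof.
move=> t; apply: (@continuous_comp _ _ _ (fun t => t - x) (fun y => y ^+ k)).
  by apply: cvgB; [exact: cvg_id|exact: cvg_cst].
exact: exprn_continuous.
Qed.

Let nR : 0 < n%:R :> R. Proof. by rewrite ltr0n. Qed.

Let c k : R := 2 ^+ k.-1 / n%:R ^+ k.
Let c0 k : 0 <= c k. Proof. by rewrite divr_ge0 ?exprn_ge0 ?(ltW nR). Qed.

Let dom x k v h : (0 < k)%N -> 0 <= h <= n%:R^-1 ->
  `|monomial x k (h + v / n%:R)| <= c k + c k * `|n%:R * x - v| ^+ k.
Proof.
move=> k0 hn; rewrite normrX; have := cell_dist_pow_le x v n0 k0 hn.
by rewrite mulrDr mulr1.
Qed.

Let mdom k : measurable_fun [set: R] (fun u : R => c k + c k * `|u| ^+ k).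
Proof.
by apply: measurable_funD => //; apply: measurable_funM => //; exact: measurable_normX.
Qed.

Let dom_integral_le x k : (\int[mu]_v ((c k + c k * `|n%:R * x - v| ^+ k)
    * Psi b q (n%:R * x - v))%:E
  <= (c k + c k * ((q + q^-1) * (expR b * k`!%:R / b ^+ k)))%:E)%E.
Proof.
apply: (@integral_affine_Psi_le _ b q b0 q0 (fun u => `|u| ^+ k)) => //.
- exact: measurable_normX.
- exact: integral_moment_Psi_le.
Qed.

Lemma Bstar_integrable_monomial x k : Bstar_integrable b q n (monomial x k) x.
Proof.
case: k => [|k].
  rewrite (_ : monomial x 0 = cst 1); last by apply/funext => t; rewrite expr0.
  exact: (Bstar_cst b0 q0 n0 1 x).1.
apply: (dominated_Bstar_integrable b0 q0 n0 (@continuous_monomial x k.+1) (mdom k.+1)).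
  by move=> v h; exact: dom.
exact: le_lt_trans (dom_integral_le x k.+1) (ltry _).
Qed.

(* The bound on [Psi] is integrable against [|u|^k] down to [u = 0], so the summand of
   [momcoef] with [(1 - expR (- b)) / (1 + expR (- b))] is only slack. *)
Lemma Bstar_monomial_le x k : (0 < k)%N ->
  (`|Bstar b q n (monomial x k) x| <= (momcoef b q n k)%:E)%E.
Proof.
move=> k0; apply: (@le_trans _ _ (c k + c k * ((q + q^-1) * (expR b * k`!%:R / b ^+ k)))%:E).
  apply: le_trans (dom_integral_le x k).
  apply: (Bstar_le b0 q0 n0 (@continuous_monomial x k) (mdom k)).
  by move=> v h; exact: dom.
rewrite lee_fin /momcoef -/(c k) -[X in X + _ <= _]mulr1 -mulrDr ler_wpM2l//.
rewrite lerD2r lerDl mulr_ge0 ?invr_ge0// divr_ge0//.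
by rewrite subr_ge0 expR_le1 oppr_le0 ltW.
Qed.

Section remainder.
Variables (f : R -> R) (N : nat) (W S T : R).
Hypotheses (N0 : (0 < N)%N) (hf : CN N f) (T0 : 0 <= T).
(** With [T = n^(1 - alpha)] this is [1/n + 1/n^alpha], the radius in [sigma]. *)
Let delta : R := (1 + T) / n%:R.
Hypothesis fW : forall y z, `|y - z| <= delta ->
  `|derive1n N f y - derive1n N f z| <= W.
Hypothesis fS : forall y, `|derive1n N f y| <= S.

Let delta0 : 0 <= delta.
Proof. by rewrite divr_ge0 ?addr_ge0// ltW. Qed.

Let W0 : 0 <= W.
Proof. by have := @fW 0 0; rewrite !subrr !normr0; exact. Qed.

Let S0 : 0 <= S. Proof. exact: le_trans (fS 0). Qed.

Let A : R := W * (delta ^+ N / N`!%:R).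
Let A0 : 0 <= A.
Proof. by rewrite mulr_ge0// divr_ge0// exprn_ge0. Qed.

(** [2 * S] bounds any difference of values of [f^(N)], and [c N] comes from the power of the
    distance to the node. *)
Let C : R := 2 * S / N`!%:R * c N.
Let C0 : 0 <= C.
Proof. by rewrite mulr_ge0// divr_ge0// mulr_ge0. Qed.

Let H (u : R) : R := \1_(far T) u * (1 + `|u| ^+ N).
Let H0 u : 0 <= H u.
Proof. by rewrite mulr_ge0// addr_ge0. Qed.

Let mH : measurable_fun [set: R] H.
Proof.
apply: measurable_funM; first exact: measurable_indic_far.
by apply: measurable_funD => //; exact: measurable_normX.
Qed.

Lemma CN_continuous : continuous f.
Proof.
move=> y; apply/differentiable_continuous/derivable1_diffP.
exact: (hf.1 0%N y N0).
Qed.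

Lemma continuous_taylor_rest x : continuous (taylor_rest f x N).
Proof.
move=> y; apply: cvgB; first exact: CN_continuous.
apply: cvg_big => [|k _]; first exact: add_continuous.
by apply: cvgM; [exact: cvg_cst|exact: continuous_monomial].
Qed.

(** Near nodes use only [A], far nodes only the term with [C]; the other term is nonnegative and is
    added for free. *)
Let rest_dom x v h : 0 <= h <= n%:R^-1 ->
  `|taylor_rest f x N (h + v / n%:R)| <= A + C * H (n%:R * x - v).
Proof.
move=> hn; have dist := cell_dist_le x v n0 hn.
have [uT|uT] := ltP `|n%:R * x - v| T.
- have tx : `|h + v / n%:R - x| <= delta.
    by apply: (le_trans dist); rewrite ler_wpM2r ?invr_ge0 ?(ltW nR)// lerD2l ltW.
  rewrite ler_wpDr ?mulr_ge0//.
  apply: le_trans (taylor_rest_le (C := W) hf.1 _) _.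
    by move=> y yx; apply: fW; exact: le_trans yx tx.
  by rewrite /A -mulrA ler_wpM2l// ler_wpM2r ?invr_ge0// lerXn2r ?nnegrE.
- rewrite ler_wpDl//.
  apply: le_trans (taylor_rest_le (C := 2 * S) hf.1 _) _.
    move=> y _; apply: le_trans (ler_normB _ _) _.
    by have := fS y; have := fS x; lra.
  rewrite /H indicE mem_set// mul1r /C mulrAC -!mulrA ler_wpM2l//.
  rewrite ler_wpM2l// ler_wpM2l ?invr_ge0// mulrA.
  exact: cell_dist_pow_le.
Qed.

Lemma Bstar_taylor_rest x : Bstar_integrable b q n (taylor_rest f x N) x /\
  (`|Bstar b q n (taylor_rest f x N) x| <=
    (W * (delta ^+ N / N`!%:R) + S * (2 ^+ N / (n%:R ^+ N * N`!%:R) * (q + q^-1)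
      * expR b * expR (- (b * T / 2))
      * (1 + 2 ^+ N.+1 * N`!%:R / b ^+ N)))%:E)%E.
Proof.
have I := integral_affine_Psi_le b0 q0 mH H0 A0 C0
  (integral_tail_Psi_le (n%:R * x) N b0 q0 T0).
have mB : measurable_fun [set: R] (fun u => A + C * H u).
  by apply: measurable_funD => //; exact: measurable_funM.
split.
  apply: (dominated_Bstar_integrable b0 q0 n0 (@continuous_taylor_rest x) mB).
    by move=> v h; exact: rest_dom.
  exact: le_lt_trans I (ltry _).
apply: (le_trans (Bstar_le b0 q0 n0 (@continuous_taylor_rest x) mB _)).
  by move=> v h; exact: rest_dom.
apply: (le_trans I); rewrite lee_fin le_eqVlt; apply/orP; left; apply/eqP.
rewrite /A /C /c; congr (_ + _).
have -> : 2 ^+ N = 2 * 2 ^+ N.-1 :> R by rewrite -exprS prednK.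
have NN : N`!%:R != 0 :> R by rewrite pnatr_eq0 -lt0n fact_gt0.
have nN : n%:R ^+ N != 0 :> R by rewrite gt_eqF// exprn_gt0.
have bN : b ^+ N != 0 by rewrite gt_eqF// exprn_gt0.
have qN : q != 0 by rewrite gt_eqF.
move: (N`!%:R) (n%:R ^+ N) (b ^+ N) NN nN bN => a1 a2 a3 h1 h2 h3.
by field; rewrite h1 h2 h3 qN.
Qed.

End remainder.

(** Convergence for [f] is not assumed: starting from the rest, the monomials are added one at a
    time, each step preserving integrability by [Bstar_linear], until [f] is recovered. *)
Lemma Bstar_expansion f x N : continuous f ->
  continuous (taylor_rest f x N) -> Bstar_integrable b q n (taylor_rest f x N) x ->
  (Bstar b q n f x = Bstar b q n (taylor_rest f x N) x
    + \sum_(k < N.+1) (derive1n k f x / k`!%:R)%:E * Bstar b q n (monomial x k) x)%E.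
Proof.
move=> cf cr ir; pose a k := derive1n k f x / k`!%:R.
pose g m t := taylor_rest f x N t + \sum_(k < m) a k * (t - x) ^+ k.
have gS m : g m.+1 = (fun t => g m t + a m * monomial x m t).
  by apply/funext => t; rewrite /g big_ord_recr/= addrA.
have cg m : continuous (g m).
  elim: m => [|m IH] t.
    rewrite (_ : g 0%N = taylor_rest f x N); first exact: cr.
    by apply/funext => u; rewrite /g big_ord0 addr0.
  rewrite gS; apply: cvgD; first exact: IH.
  by apply: cvgM; [exact: cvg_cst|exact: continuous_monomial].
have {1}-> : f = g N.+1.
  by apply/funext => t; rewrite /g /taylor_rest subrK.
suff H m : Bstar_integrable b q n (g m) x /\ (Bstar b q n (g m) x =
    Bstar b q n (taylor_rest f x N) x
    + \sum_(k < m) (a k)%:E * Bstar b q n (monomial x k) x)%E by exact: (H _).2.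
elim: m => [|m [IH1 IH2]].
  rewrite (_ : g 0%N = taylor_rest f x N) ?big_ord0 ?adde0//.
  by apply/funext => u; rewrite /g big_ord0 addr0.
have [H1 H2] := Bstar_linear (a m) (cg m) (@continuous_monomial x m) IH1
  (Bstar_integrable_monomial x m).
rewrite gS; split => //; rewrite H2 IH2 big_ord_recr/= addeA//.
Qed.

End moments_of_operator.

Lemma momcoef_ge0 (R : realType) (b q : R) n k : 0 <= b -> 0 <= q ->
  0 <= momcoef b q n k.
Proof.
move=> b0 q0; apply: mulr_ge0; first by rewrite divr_ge0 ?exprn_ge0.
rewrite !addr_ge0// mulr_ge0 ?addr_ge0 ?invr_ge0//.
  by rewrite divr_ge0// subr_ge0 expR_le1 oppr_le0.
by rewrite divr_ge0 ?exprn_ge0// mulr_ge0 ?expR_ge0.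
Qed.

Section suprema.
Context {R : realType}.
Implicit Types (g : R -> R) (theta M : R).

Lemma modcont_ub g theta y z : `|y - z| <= theta ->
  ((`|g y - g z|)%:E <= modcont g theta)%E.
Proof. by move=> yz; apply: ereal_sup_ubound; exists (y, z). Qed.

Lemma supnorm_ub (g : R -> \bar R) y : (`|g y| <= supnorm g)%E.
Proof. by apply: ereal_sup_ubound; exists y. Qed.

Lemma modcont_ge0 g theta : 0 <= theta -> (0 <= modcont g theta)%E.
Proof.
move=> t0; have := @modcont_ub g theta 0 0.
by rewrite !subrr !normr0; exact.
Qed.

Lemma supnorm_ge0 (g : R -> \bar R) : (0 <= supnorm g)%E.
Proof. exact: le_trans (abse_ge0 _) (supnorm_ub g 0). Qed.

Lemma modcont_le g theta M : (forall y, `|g y| <= M) ->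
  (modcont g theta <= (2 * M)%:E)%E.
Proof.
move=> gM; apply: ge_ereal_sup => _ /= [p _ <-]; rewrite lee_fin.
apply: le_trans (ler_normB _ _) _.
by have := gM p.1; have := gM p.2; lra.
Qed.

Lemma supnorm_le g M : (forall y, `|g y| <= M) -> (supnorm (EFin \o g) <= M%:E)%E.
Proof. by move=> gM; apply: ge_ereal_sup => _ /= [p _ <-]; rewrite lee_fin. Qed.

Lemma modcont_fin_num g theta M : 0 <= theta -> (forall y, `|g y| <= M) ->
  modcont g theta \is a fin_num.
Proof.
move=> t0 gM; rewrite ge0_fin_numE ?modcont_ge0//.
exact: le_lt_trans (modcont_le _ gM) (ltry _).
Qed.

Lemma supnorm_fin_num g M : (forall y, `|g y| <= M) ->
  supnorm (EFin \o g) \is a fin_num.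
Proof.
move=> gM; rewrite ge0_fin_numE ?supnorm_ge0//.
exact: le_lt_trans (supnorm_le gM) (ltry _).
Qed.

End suprema.

(** * The error term tends to zero *)

Section sigma_limit.
Context {R : realType}.

Lemma cvg_powR_inv (alpha : R) : 0 < alpha ->
  ((m%:R : R) `^ alpha)^-1 @[m --> \oo] --> (0 : R).
Proof.
move=> a0; apply/gtr0_cvgV0.
  near=> m; apply: powR_gt0; rewrite ltr0n; near: m.
  exact: nbhs_infty_gt.
apply/cvgryPge => A; near=> m.
have [A0|A0] := leP A 0; first by rewrite (le_trans A0)// powR_ge0.
(* Written as a power with exponent [alpha], [A] is exceeded as soon as [m] exceeds
   [A^(1/alpha)]. *)
have -> : A = (A `^ alpha^-1) `^ alpha.
  by rewrite -powRrM mulVf ?gt_eqF// powRr1// ltW.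
apply: ge0_ler_powR; rewrite ?nnegrE ?powR_ge0 ?ler0n// ?(ltW a0)//.
near: m; exact: nbhs_infty_ger.
Unshelve. all: end_near. Qed.

Lemma cvg_natr_inv : (m%:R : R)^-1 @[m --> \oo] --> (0 : R).
Proof.
have := @cvg_powR_inv 1 ltr01.
by under eq_cvg do rewrite powRr1//.
Qed.

Lemma cvg_exprn0 (u : nat -> R) (k : nat) : (0 < k)%N ->
  u m @[m --> \oo] --> (0 : R) -> u m ^+ k @[m --> \oo] --> (0 : R).
Proof.
move=> k0 u0; have := @exprn_continuous R k 0; rewrite /continuous_at expr0n eqn0Ngt k0.
by move=> ck; exact: (cvg_comp _ _ u0 ck).
Qed.

(* [modcont] is only bounded here, since [f^(N)] need not be uniformly continuous;
   the factor [delta ^+ N] with [0 < N] forces the limit. *)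
Lemma sigma_cvg0 (b q alpha : R) (N : nat) (f : R -> R) :
  0 < b -> 0 < q -> 0 < alpha -> (0 < N)%N -> CB (derive1n N f) ->
  (sigma b q alpha N f m @[m --> \oo] --> (0 : \bar R))%E.
Proof.
move=> b0 q0 a0 N0 [_ [M fM]].
have M0 : 0 <= M by exact: le_trans (fM 0).
(* All factors independent of [m]. The exponential [E] is merely bounded by 1, since [m^-N] already
   tends to 0. *)
pose C : R := 2 ^+ N / N`!%:R * (q + q^-1) * expR b
  * (1 + 2 ^+ N.+1 * N`!%:R / b ^+ N).
have C0 : 0 <= C.
  by rewrite !mulr_ge0 ?addr_ge0 ?invr_ge0 ?mulr_ge0 ?invr_ge0 ?exprn_ge0 ?expR_ge0// ltW.
pose dlt (m : nat) : R := m%:R^-1 + (m%:R `^ alpha)^-1.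
have dlt0 m : 0 <= dlt m by rewrite addr_ge0 ?invr_ge0 ?powR_ge0.
pose F (m : nat) : R := 2 * M * (dlt m ^+ N / N`!%:R) + M * (C * (m%:R^-1) ^+ N).
have F0 : F m @[m --> \oo] --> (0 : R).
  rewrite -[X in _ --> X](addr0 0) -[X in X + _](mulr0 (2 * M)) -[X in _ + X](mulr0 M).
  rewrite -[X in _ * X + _](mul0r (N`!%:R^-1)) -[X in _ + _ * X](mulr0 C).
  apply: cvgD.
    apply: cvgM; first exact: cvg_cst.
    apply: cvgM; last exact: cvg_cst.
    apply: cvg_exprn0 => //; rewrite -[X in _ --> X](addr0 0).
    by apply: cvgD; [exact: cvg_natr_inv|exact: cvg_powR_inv].
  apply: cvgM; first exact: cvg_cst.
  apply: cvgM; first exact: cvg_cst.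
  by apply: cvg_exprn0 => //; exact: cvg_natr_inv.
apply: (@squeeze_cvge _ _ _ _ (cst 0%E) _ (EFin \o F)); last 2 first.
- exact: cvg_cst.
- by apply: cvg_EFin; [exact: nearW|].
apply: nearW => m /=; rewrite /sigma -/(dlt m).
set E := expR (- (b * m%:R `^ (1 - alpha) / 2)).
have -> : 2 ^+ N / (m%:R ^+ N * N`!%:R) * (q + q^-1) * expR b * E *
    (1 + 2 ^+ N.+1 * N`!%:R / b ^+ N) = E * (C * (m%:R^-1) ^+ N).
  rewrite /C invfM exprVn; ring.
have E0 : 0 <= E by exact: expR_ge0.
have E1 : E <= 1.
  by rewrite expR_le1 oppr_le0 !mulr_ge0 ?invr_ge0 ?powR_ge0// ltW.
have CN0 : 0 <= C * (m%:R^-1) ^+ N by rewrite mulr_ge0// exprn_ge0 ?invr_ge0.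
have dN0 : 0 <= dlt m ^+ N / N`!%:R by rewrite divr_ge0// exprn_ge0.
apply/andP; split.
  by rewrite adde_ge0// mule_ge0 ?modcont_ge0 ?supnorm_ge0 ?lee_fin// mulr_ge0.
rewrite /F EFinD leeD// ?(EFinM (2 * M)) ?(EFinM M).
  by apply: lee_wpmul2r => //; exact: modcont_le.
apply: (@le_trans _ _ (M%:E * (E * (C * m%:R^-1 ^+ N))%:E)%E).
  apply: lee_wpmul2r; first by rewrite lee_fin mulr_ge0.
  exact: supnorm_le.
by rewrite -EFinM lee_fin ler_wpM2l// ler_piMl.
Qed.

End sigma_limit.

Section main.
Context {R : realType}.
Variables (q b alpha : R) (n N : nat) (f : R -> R).
Hypotheses (q0 : 0 < q) (b0 : 0 < b) (n0 : (0 < n)%N) (N0 : (0 < N)%N).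
Hypotheses (hf : CN N f) (hfN : CB (derive1n N f)).
Local Notation monomial x k := (fun t : R => (t - x) ^+ k).

(** Here [r] is the operator applied to the Taylor rest and [s] the sum of the moment terms. Having
    them as real numbers reduces (i) and (iii) to arithmetic free of infinities. *)
Lemma Bstar_decomposition (x : R) : exists r s : R,
  [/\ Bstar b q n f x = (r + f x + s)%:E,
      (\sum_(1 <= k < N.+1) (derive1n k f x / k`!%:R)%:E
        * Bstar b q n (monomial x k) x)%E = s%:E,
      ((`|r|)%:E <= sigma b q alpha N f n)%E &
      `|s| <= \sum_(1 <= k < N.+1) `|derive1n k f x| / k`!%:R * momcoef b q n k].
Proof.
have nR : 0 < n%:R :> R by rewrite ltr0n.
have [M fM] := hfN.2.
pose T : R := n%:R `^ (1 - alpha).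
pose delta : R := n%:R^-1 + (n%:R `^ alpha)^-1.
have T0 : 0 <= T by exact: powR_ge0.
have deltaE : (1 + T) / n%:R = delta.
  rewrite /T /delta powRB; last by rewrite (gt_eqF nR) /= implybT.
  by rewrite powRr1 ?ltW//; field; rewrite !gt_eqF// powR_gt0.
have delta0 : 0 <= delta by rewrite addr_ge0 ?invr_ge0 ?powR_ge0.
(* Boundedness of [f^(N)] makes both suprema finite, so their real values can serve as [W] and
   [S]. *)
have Wfin := modcont_fin_num delta0 fM; have Sfin := supnorm_fin_num fM.
pose W := fine (modcont (derive1n N f) delta).
pose S := fine (supnorm (EFin \o derive1n N f)).
have fW y z : `|y - z| <= (1 + T) / n%:R -> `|derive1n N f y - derive1n N f z| <= W.
  by rewrite deltaE => yz; rewrite -lee_fin fineK//; exact: modcont_ub.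
have fS y : `|derive1n N f y| <= S.
  by rewrite -lee_fin fineK//; exact: (supnorm_ub (EFin \o derive1n N f) y).
have [ir rle] := Bstar_taylor_rest b0 q0 n0 N0 hf T0 fW fS x.
have := Bstar_expansion b0 q0 n0 (CN_continuous N0 hf)
  (continuous_taylor_rest N0 hf (x := x)) ir.
have rfin := Bstar_fin_num ir.
have mfin k : Bstar b q n (monomial x k) x \is a fin_num.
  exact: (Bstar_fin_num (Bstar_integrable_monomial b0 q0 n0 x k)).
pose s := \sum_(1 <= k < N.+1) derive1n k f x / k`!%:R
   * fine (Bstar b q n (monomial x k) x).
have sE : (\sum_(1 <= k < N.+1) (derive1n k f x / k`!%:R)%:E
        * Bstar b q n (monomial x k) x)%E = s%:E.
  by rewrite /s -sumEFin; apply: eq_bigr => k _; rewrite [in RHS]EFinM (fineK (mfin k)).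
(* The term [k = 0] is split off: its moment is 1, so it contributes [f x]. *)
rewrite -(big_mkord xpredT (fun k => (derive1n k f x / k`!%:R)%:E
        * Bstar b q n (monomial x k) x)%E) big_ltn// sE.
have -> : Bstar b q n (monomial x 0) x = 1%:E.
  rewrite (_ : monomial x 0 = cst 1); last by apply/funext => t; rewrite expr0.
  exact: (Bstar_cst b0 q0 n0 1 x).2.
rewrite mule1 derive1n0 divr1 => BE.
exists (fine (Bstar b q n (taylor_rest f x N) x)), s; split => //.
- by rewrite BE -{1}(fineK rfin) -!EFinD addrA.
- rewrite -abse_EFin fineK//; apply: (le_trans rle).
  by rewrite deltaE /sigma -/delta -/T -(fineK Wfin) -(fineK Sfin) -!EFinM -EFinD.
- apply: (le_trans (ler_norm_sum _ _ _)).
  rewrite big_nat [leRHS]big_nat; apply: ler_sum => k /andP[k0 _].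
  rewrite normrM normrM normfV normr_nat ler_wpM2l ?divr_ge0//.
  by rewrite -lee_fin -abse_EFin (fineK (mfin k)); exact: Bstar_monomial_le.
Qed.

End main.

Unset Implicit Arguments.
Set Strict Implicit.
Local Open Scope ereal_scope.

Theorem theorem11 (R : realType) (q beta alpha : R) (n : nat) (x : R)
    (N : nat) (f : R -> R)
    (hq : (0 < q)%R) (hbeta : (0 < beta)%R)
    (halpha0 : (0 < alpha)%R) (halpha1 : (alpha < 1)%R)
    (hn : (0 < n)%N) (hn2 : (2 < (n%:R : R) `^ (1 - alpha))%R)
    (hN : (0 < N)%N) (hf : CN N f) (hfN : CB (derive1n N f)) :
  [/\ (* (i) *)
      `| Bstar beta q n f x - (f x)%:E
         - \sum_(1 <= k < N.+1)
             (derive1n k f x / k`!%:R)%:E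
             * Bstar beta q n (fun t : R => (t - x) ^+ k)%R x |
        <= sigma beta q alpha N f n
      /\ sigma beta q alpha N f m @[m --> \oo] --> (0 : \bar R),
      (* (ii) *)
      (forall k : nat, (1 <= k <= N)%N -> derive1n k f x = 0%R) ->
      `| Bstar beta q n f x - (f x)%:E | <= sigma beta q alpha N f n,
      (* (iii) *)
      `| Bstar beta q n f x - (f x)%:E | <=
        \sum_(1 <= k < N.+1)
          (`|derive1n k f x| / k`!%:R * momcoef beta q n k)%R%:E
        + sigma beta q alpha N f n
    & (* (iv) *)
      supnorm (fun y : R => Bstar beta q n f y - (f y)%:E) <=
        \sum_(1 <= k < N.+1)
          supnorm (EFin \o derive1n k f) * (momcoef beta q n k / k`!%:R)%R%:E
        + sigma beta q alpha N f n ].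
Proof.
have decomp := Bstar_decomposition alpha hq hbeta hn hN hf hfN.
(* Stated for every [y], since (iv) takes the supremum of these bounds. *)
have iii y : `|Bstar beta q n f y - (f y)%:E| <=
    \sum_(1 <= k < N.+1)
      (`|derive1n k f y| / k`!%:R * momcoef beta q n k)%R%:E
    + sigma beta q alpha N f n.
  have [r [s [-> _ rle sle]]] := decomp y.
  rewrite -EFinB (_ : (r + f y + s - f y = s + r)%R); last by ring.
  apply: (@le_trans _ _ (`|s|%:E + `|r|%:E)%E).
    by rewrite -EFinD lee_fin ler_normD.
  by apply: leeD => //; rewrite sumEFin lee_fin.
have i : `| Bstar beta q n f x - (f x)%:E
    - \sum_(1 <= k < N.+1) (derive1n k f x / k`!%:R)%:E
        * Bstar beta q n (fun t : R => (t - x) ^+ k)%R x |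
    <= sigma beta q alpha N f n.
  have [r [s [-> -> rle _]]] := decomp x.
  by rewrite -!EFinB (_ : (r + f x + s - f x - s = r)%R)//; ring.
split => //.
- by split => //; exact: sigma_cvg0.
- move=> f0; move: i; rewrite big1_seq ?sube0// => k.
  by rewrite mem_index_iota => /andP[_ kN]; rewrite f0// mul0r mul0e.
- apply: ge_ereal_sup => _ /= [y _ <-].
  apply: (le_trans (iii y)); apply: leeD => //.
  (* Regrouped so that the derivative stands alone against its possibly infinite norm, multiplied by
     a nonnegative real. *)
  apply: lee_sum => k _; rewrite mulrAC -mulrA EFinM; apply: lee_wpmul2r.
    by rewrite lee_fin divr_ge0 ?momcoef_ge0// ltW.
  exact: (supnorm_ub (EFin \o derive1n k f) y).
Qed.
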